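(* Let $S$ be an inverse semigroup without zero, and let $1_S$ denote the identity relation on $S$. Then: (i) $\mathrm{diam}(\Gamma(S^0)) = 1$ if and only if $|S| > 1$ and $\sigma = 1_S$; (ii) $\mathrm{diam}(\Gamma(S^0)) = 2$ if and only if $|S/\sigma| \ge 2$ and $\sigma \ne 1_S$; (iii) $\mathrm{diam}(\Gamma(S^0)) \in \{1, 2\}$ if and only if $|S/\sigma| \ge 2$.
   Context: For an inverse semigroup $T$ with set of idempotents $E(T)$, the natural partial order is: $a \le b$ iff $a = eb$ for some $e \in E(T)$. A semigroup ''with zero'' is one with at least two elements containing an element $0$ such that $0x = x0 = 0$ for all $x$; thus a one-element semigroup counts as being without zero. If $S$ has no zero, $S^0 = S \cup \{0\}$ denotes $S$ with an external zero adjoined. For an inverse semigroup $T$ with zero and $a, b \in T$, $\omega(a,b) = \{c \in T : c \le a \text{ and } c \le b\}$. The zero-divisor graph $\Gamma(T)$ is the simple undirected graph with vertex set $Z(T)^\times = \{a \in T\setminus\{0\} : \exists\, b \in T \setminus\{0\},\ \omega(a,b) = \{0\}\}$, in which two distinct vertices $a, b$ are adjacent iff $\omega(a,b) = \{0\}$. The least group congruence $\sigma$ on $S$ is given by: $a\,\sigma\,b$ iff $ea = fb$ for some $e, f \in E(S)$. The distance between two distinct vertices is the length of a shortest path joining them ($\infty$ if there is none), and $\mathrm{diam}$ of a graph is the largest distance between pairs of distinct vertices (a graph with no vertices does not have diameter $1$ or $2$). *)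

(* Defs.v *)
From HB Require Import structures.
From mathcomp Require Import all_boot.
From mathcomp Require Import boolp classical_sets functions cardinality.

Set Implicit Arguments.
Unset Strict Implicit.
Unset Printing Implicit Defensive.

Local Open Scope classical_set_scope.
Local Open Scope group_scope.

Section InverseSemigroups.
Variable T : semigroupType.
Implicit Types a b c e f z : T.

Definition inverse_of a b : Prop := a * b * a = a /\ b * a * b = b.

Definition inverse_semigroup : Prop := forall a, exists! b, inverse_of a b.

Definition idempotents : set T := [set e | e * e = e].

Definition natural_le a b : Prop := exists2 e, idempotents e & a = e * b.

Definition absorbing z : Prop := forall x, z * x = z /\ x * z = z.

(* The one-element semigroup does not count as a semigroup with zero. *)
Definition with_zero : Prop :=
  (exists x y : T, x <> y) /\ (exists z, absorbing z).

Definition omega a b : set T := [set c | natural_le c a /\ natural_le c b].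

Definition sigma a b : Prop :=
  exists e f, [/\ idempotents e, idempotents f & e * a = f * b].

(* The quotient T/sigma as a set of subsets of T: [sigma a], read as a set, is
   the class of a. *)
Definition quotient_sigma : set (set T) := range sigma.

Lemma omegaC a b : omega a b = omega b a.
Proof. by apply/seteqP; split => c [? ?]; split. Qed.

End InverseSemigroups.

Arguments sigma : clear implicits.
Arguments quotient_sigma : clear implicits.

Definition adjoin0 (S : Type) : Type := option S.

HB.instance Definition _ (S : choiceType) := Choice.on (adjoin0 S).

Section AdjoinZero.
Variable S : semigroupType.

Definition zero0 : adjoin0 S := None.

Definition mul0 (x y : adjoin0 S) : adjoin0 S :=
  match x, y with
  | Some a, Some b => Some (a * b)
  | _, _ => None
  end.

Lemma mul0A : associative mul0.
Proof. by move=> [a|] [b|] [c|] //=; rewrite mulgA. Qed.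

HB.instance Definition _ := isSemigroup.Build (adjoin0 S) mul0A.

Lemma absorbing_zero0 : absorbing zero0.
Proof. by case. Qed.

Lemma inverse_semigroup_adjoin0 :
  inverse_semigroup S -> inverse_semigroup (adjoin0 S).
Proof.
move=> invS [a|]; last first.
  by exists None; split; [split | case=> [b|] // -[]].
have [b [[aba bab] b_uniq]] := invS a.
exists (Some b); split; first by split; congr Some.
by case=> [c|] [] // [aca] [cac]; congr Some; apply: b_uniq.
Qed.

End AdjoinZero.

Record simple_graph (V : Type) := SimpleGraph {
  vertices : set V;
  edge : rel V;
  edge_vertices : forall x y, edge x y -> vertices x /\ vertices y;
  edge_sym : symmetric edge;
  edge_irr : irreflexive edge
}.

Section Distance.
Variables (V : eqType) (G : simple_graph V).

Definition joined_in (x y : V) (n : nat) : Prop :=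
  exists p : seq V, [/\ path (edge G) x p, last x p = y, uniq (x :: p) & size p = n].

Lemma asbool_joined_in (x y : V) :
  (exists n, joined_in x y n) -> exists n, `[< joined_in x y n >].
Proof. by case=> n xy; exists n; apply/asboolP. Qed.

(* [Some n] is the length n of a shortest path, [None] is infinity. *)
Definition distance (x y : V) : option nat :=
  match pselect (exists n, joined_in x y n) with
  | left xy => Some (ex_minn (asbool_joined_in xy))
  | right _ => None
  end.

Definition distances : set (option nat) :=
  [set d | exists x y, [/\ vertices G x, vertices G y, x <> y & d = distance x y]].

Definition extended_le (d d' : option nat) : Prop :=
  match d, d' with
  | _, None => True
  | None, Some _ => False
  | Some m, Some n => (m <= n)%N
  end.

(* A relation, since the set of distances may be empty. *)
Definition has_diameter (d : option nat) : Prop :=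
  distances d /\ forall d', distances d' -> extended_le d' d.

End Distance.

Section ZeroDivisorGraph.
Variables (T : semigroupType) (z : T).

Definition zero_divisors : set T :=
  [set a | a <> z /\ exists2 b, b <> z & omega a b = [set z]].

Definition zd_adjacent : rel T := fun a b =>
  `[< [/\ zero_divisors a, zero_divisors b, a <> b & omega a b = [set z]] >].

Lemma zd_adjacent_vertices a b :
  zd_adjacent a b -> zero_divisors a /\ zero_divisors b.
Proof. by move/asboolP=> []. Qed.

Lemma zd_adjacent_sym : symmetric zd_adjacent.
Proof.
by move=> a b; apply/asboolP/asboolP => -[? ? ab ?]; split=> //;
  [exact: nesym | rewrite omegaC | exact: nesym | rewrite omegaC].
Qed.

Lemma zd_adjacent_irr : irreflexive zd_adjacent.
Proof. by move=> a; apply/asboolP => -[]. Qed.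

Definition zero_divisor_graph : simple_graph T :=
  SimpleGraph zd_adjacent_vertices zd_adjacent_sym zd_adjacent_irr.

End ZeroDivisorGraph.

Definition zero_divisor_graph0 (S : semigroupType) : simple_graph (adjoin0 S) :=
  zero_divisor_graph (zero0 S).

(* Main.v *)
(** For [a] and [b] in [S], a nonzero common lower bound in [S^0] is an element
    [ea = fb] with [e] and [f] idempotent, so [omega a b = {0}] holds exactly
    when [a] and [b] are not [sigma]-related.  Hence, as soon as [sigma] has two
    classes, the graph is the complete multipartite graph on [S] whose parts are
    the [sigma]-classes: adjacent vertices are at distance 1, and two vertices
    of the same class are at distance 2, through any vertex of another class. *)

Require Import Defs.
From HB Require Import structures.
From mathcomp Require Import all_boot.
From mathcomp Require Import boolp classical_sets functions cardinality.

Local Open Scope classical_set_scope.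
Local Open Scope card_scope.

Lemma card_ge2P (T : Type) (A : set T) :
  `I_2 #<= A <-> exists x y, [/\ A x, A y & x <> y].
Proof.
split=> [/card_leP[f]|[x [y [Ax Ay xy]]]].
  have I0 : 0%N \in `I_2 by rewrite inE.
  have I1 : 1%N \in `I_2 by rewrite inE.
  exists (val (f (SigSub I0))), (val (f (SigSub I1))).
  split; try exact: set_valP.
  by move=> /val_inj fE; have [] := inj (in_setT _) (in_setT _) fE.
have /injfunPex[f] : exists2 g : nat -> T,
    set_fun `I_2 A g & {in `I_2 &, injective g}.
  exists (fun n => if n == 0%N then x else y).
    by move=> n _ /=; case: ifP.
  move=> m n; rewrite !inE /=.
  by case: m n => [|[|m]] [|[|n]] //= _ _ => /esym.
exact: inj_card_le f.
Qed.

Section InverseSemigroup.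
Local Open Scope group_scope.
Variable S : semigroupType.
Hypothesis invS : inverse_semigroup S.
Implicit Types a b c e f x y : S.

Lemma inverse_of_inj a x y : inverse_of a x -> inverse_of a y -> x = y.
Proof. by have [z [_ z_uniq]] := invS a => /z_uniq <- /z_uniq. Qed.

Lemma mul_idempotentK y e : idempotents e -> y * e * e = y * e.
Proof. by move=> ee; rewrite -mulgA ee. Qed.

Lemma idempotentsM e f :
  idempotents e -> idempotents f -> idempotents (e * f).
Proof.
move=> ee ff.
have [x [[efx xef] _]] := invS (e * f); rewrite !mulgA in efx xef.
(* If [x] is the inverse of [ef], then so is [fxe], which is idempotent. *)
have fxeE : f * x * e = x.
  apply: (inverse_of_inj (e * f)); split; rewrite !mulgA //.
    by rewrite !mul_idempotentK.
  by rewrite !mul_idempotentK // -[in RHS]xef !mulgA.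
have xx : x * x = x.
  by rewrite -{1 2}fxeE -[RHS]fxeE -[in RHS]xef !mulgA.
(* The idempotent [x] is its own inverse, and [e * f] is an inverse of [x] too. *)
suff -> : e * f = x by [].
by apply: (inverse_of_inj x); split; rewrite ?mulgA ?xx.
Qed.

(** Both [e * f] and [f * e] are inverses of [e * f], because both products are idempotent. *)
Lemma idempotentsC e f : idempotents e -> idempotents f -> e * f = f * e.
Proof.
move=> ee ff.
have ef : e * f * (e * f) = e * f by exact: idempotentsM.
have fe : f * e * (f * e) = f * e by exact: idempotentsM.
apply: (inverse_of_inj (e * f)); split; rewrite ?ef // !mulgA.
  by rewrite !mul_idempotentK // -[RHS]ef mulgA.
by rewrite !mul_idempotentK // -[RHS]fe mulgA.
Qed.

Lemma sigma_refl a : sigma S a a.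
Proof.
have [b [[aba _] _]] := invS a.
(* Any idempotent taken on both sides would do; the inverse [b] of [a] supplies [a * b]. *)
by exists (a * b), (a * b); split; rewrite /idempotents //= mulgA aba.
Qed.

Lemma sigma_sym a b : sigma S a b -> sigma S b a.
Proof. by case=> e [f [? ? ?]]; exists f, e. Qed.

(** From [e * a = f * b] and [g * b = h * c], commuting idempotents give [gea = gfb = fgb = fhc]. *)
Lemma sigma_trans b a c : sigma S a b -> sigma S b c -> sigma S a c.
Proof.
move=> [e [f [ee ff ea]]] [g [h [gg hh gb]]].
exists (g * e), (f * h); split; [exact: idempotentsM..|].
by rewrite -!mulgA ea -gb !mulgA (idempotentsC _ _ gg ff).
Qed.

(** As [sigma] is an equivalence, two classes coincide as sets exactly when their representatives
    are related. *)
Lemma quotient_sigma_ge2P :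
  `I_2 #<= quotient_sigma S <-> exists a b, ~ sigma S a b.
Proof.
split=> [/card_ge2P[_ [_ [[a _ <-] [b _ <-] ab]]]|[a [b ab]]].
  exists a, b => sab; apply: ab; apply/seteqP; split=> c.
    by apply: sigma_trans; exact: sigma_sym.
  exact: sigma_trans.
apply/card_ge2P; exists (sigma S a), (sigma S b).
split; [by exists a|by exists b|].
by move=> eab; apply: ab; rewrite eab; exact: sigma_refl.
Qed.

Lemma omega_adjoin0 a b :
  omega (Some a : adjoin0 S) (Some b) = [set zero0 S] <-> ~ sigma S a b.
Proof.
split=> [w0 [e [f [ee ff eafb]]]|ab].
  suff : omega (Some a : adjoin0 S) (Some b) (Some (e * a)) by rewrite w0.
  split; [exists (Some e)|exists (Some f)] => //; congr Some => //.
(* Zero lies below everything, with [None] as the idempotent. A lower bound [Some c] can only come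
   from idempotents of [S], since a factor [None] would give [None]. *)
apply/seteqP; split=> [[c|] //|_ ->]; last by split; exists None.
case=> -[[e|] //= [ee] [cea]] [[f|] //= [ff] [cfb]].
by case: ab; exists e, f; split; rewrite // -cea -cfb.
Qed.

Lemma zero_divisor_adjoin0 a b :
  ~ sigma S a b -> zero_divisors (zero0 S) (Some a).
Proof. by move=> ab; split=> //; exists (Some b) => //; apply/omega_adjoin0. Qed.

Lemma zd_adjacent_adjoin0 a b :
  zd_adjacent (zero0 S) (Some a) (Some b) <-> ~ sigma S a b.
Proof.
split=> [/asboolP[_ _ _ /omega_adjoin0]//|ab].
apply/asboolP; split; last exact/omega_adjoin0.
- exact: zero_divisor_adjoin0 ab.
- by apply: (zero_divisor_adjoin0 b a) => /sigma_sym.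
- by case=> eab; apply: ab; rewrite eab; exact: sigma_refl.
Qed.

End InverseSemigroup.

Section Distance.
Variables (V : eqType) (G : simple_graph V).

Lemma distance_eq (x y : V) n :
  joined_in G x y n -> (forall m, joined_in G x y m -> n <= m) ->
  distance G x y = Some n.
Proof.
move=> xy n_min; rewrite /distance; case: pselect => [xyE|[]]; last by exists n.
case: ex_minnP => m /asboolP xym m_min; congr Some.
by apply/eqP; rewrite eqn_leq n_min // m_min //; apply/asboolP.
Qed.

Lemma distance1 (x y : V) : edge G x y -> distance G x y = Some 1.
Proof.
move=> xy; have xNy : x != y by apply: contraTneq xy => ->; rewrite edge_irr.
apply: distance_eq => [|[|m] //].
  by exists [:: y]; split; rewrite //= ?xy // inE xNy.
by case=> -[|? ?] [_ /= exy] //; rewrite exy eqxx in xNy.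
Qed.

Lemma distance2 (x y z : V) :
  x <> y -> ~~ edge G x y -> edge G x z -> edge G z y ->
  distance G x y = Some 2.
Proof.
move=> /eqP xNy Nxy xz zy.
have xNz : x != z by apply: contraTneq xz => ->; rewrite edge_irr.
have zNy : z != y by apply: contraTneq zy => ->; rewrite edge_irr.
apply: distance_eq => [|m [p [pP pL _ <-]]].
  by exists [:: z; y]; split; rewrite //= ?xz ?zy // !inE negb_or xNz xNy zNy.
(* Only lengths 0 and 1 have to be excluded: the empty path forces [x = y], and a single step is the
   missing edge. *)
case: p pP pL => [_ /= exy|w [|//] /= /andP[xw _] wy].
  by rewrite exy eqxx in xNy.
by rewrite wy (negPf Nxy) in xw.
Qed.

End Distance.

Section Diameter.
Variable S : semigroupType.
Hypothesis invS : inverse_semigroup S.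
Local Notation G := (zero_divisor_graph0 S).
Implicit Types a b c : S.

Lemma distance_not_sigma a b :
  ~ sigma S a b -> distance G (Some a) (Some b) = Some 1.
Proof. by move=> ab; apply/distance1/zd_adjacent_adjoin0. Qed.

Lemma distance_sigma a b c :
  a <> b -> sigma S a b -> ~ sigma S a c ->
  distance G (Some a) (Some b) = Some 2.
Proof.
move=> aNb ab ac; apply: (@distance2 _ G _ _ (Some c)).
- by case.
- by apply/negP => /(zd_adjacent_adjoin0 _ invS).
- exact/zd_adjacent_adjoin0.
- apply/zd_adjacent_adjoin0 => // cb.
  by apply/ac/(sigma_trans _ invS b) => //; exact: sigma_sym.
Qed.

Lemma vertices_not_sigma x :
  vertices G x -> exists a b, x = Some a /\ ~ sigma S a b.
Proof.
case: x => [a|] [// _ [[b|] // _ /omega_adjoin0 ab]].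
by exists a, b.
Qed.

(** An element related to everything would link any two elements by transitivity. Hence, once there
    are two classes, every element of [S] is a vertex. *)
Lemma not_sigma_total : (exists a b, ~ sigma S a b) ->
  forall a, exists b, ~ sigma S a b.
Proof.
move=> [a [b ab]] c; apply: contrapT => /forallNP nc; apply: ab.
by apply: (sigma_trans _ invS c); [apply: sigma_sym|]; apply: contrapT.
Qed.

Lemma distances_not_sigma d : distances G d -> exists a b, ~ sigma S a b.
Proof. by case=> x [y [/vertices_not_sigma[a [b [_ ab]]] _ _ _]]; exists a, b. Qed.

(** This determines the whole set of distances, infinity being excluded, so that both diameters can
    be read off. *)
Lemma distances_zero_divisorP d : distances G d <->
  (exists a b, ~ sigma S a b) /\
  (d = Some 1 \/ d = Some 2 /\ exists a b, sigma S a b /\ a <> b).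
Proof.
split=> [dG|[]].
  split; first exact: distances_not_sigma dG.
  case: dG => x [y [/vertices_not_sigma[a [c [-> ac]]] + + ->]].
  move=> /vertices_not_sigma[b [_ [-> _]]] aNb.
  have {}aNb : a <> b by move=> eab; apply: aNb; rewrite eab.
  have [ab|ab] := pselect (sigma S a b).
    by right; split; [exact: distance_sigma ac|exists a, b].
  by left; exact: distance_not_sigma.
move=> ns [->|[-> [a [b [ab aNb]]]]].
  have [a [b ab]] := ns.
  exists (Some a), (Some b); split.
  - exact: zero_divisor_adjoin0 ab.
  - by apply: (zero_divisor_adjoin0 _ b a) => /sigma_sym.
  - by case=> eab; apply: ab; rewrite eab; exact: sigma_refl.
  - by rewrite distance_not_sigma.
(* [c] is the midpoint of the path and also shows that [a] is a vertex; [c'] does the latter for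
   [b]. *)
have [[c ac] [c' bc]] := (not_sigma_total ns a, not_sigma_total ns b).
exists (Some a), (Some b); split.
- exact: zero_divisor_adjoin0 ac.
- exact: zero_divisor_adjoin0 bc.
- by case.
- by rewrite (distance_sigma _ _ _ aNb ab ac).
Qed.

Lemma sigma_neq_eqP : sigma S <> @eq S <-> exists a b, sigma S a b /\ a <> b.
Proof.
split=> [sNeq|[a [b [ab aNb]]] seq]; last by rewrite seq in ab.
apply: contrapT => nex; apply: sNeq; apply/funext => a; apply/funext => b.
apply/propext; split=> [ab|<-]; last exact: sigma_refl.
by apply: contrapT => aNb; apply: nex; exists a, b.
Qed.

Lemma diameter1P : has_diameter G (Some 1) <->
  (exists a b, ~ sigma S a b) /\ sigma S = @eq S.
Proof.
split=> [[/distances_zero_divisorP[ns _] le1]|[ns seq]].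
  split=> //; apply: contrapT => /sigma_neq_eqP ex.
  (* Two distinct related elements would realise the distance 2, above the bound 1. *)
  by have /le1 : distances G (Some 2) by apply/distances_zero_divisorP; auto.
split; first by apply/distances_zero_divisorP; auto.
by move=> d /distances_zero_divisorP[_ [->//|[_ /sigma_neq_eqP]]].
Qed.

Lemma diameter2P : has_diameter G (Some 2) <->
  (exists a b, ~ sigma S a b) /\ sigma S <> @eq S.
Proof.
split=> [[/distances_zero_divisorP[ns [//|[_ ex]]] _]|[ns /sigma_neq_eqP ex]].
  by split=> //; apply/sigma_neq_eqP.
split; first by apply/distances_zero_divisorP; auto.
by move=> d /distances_zero_divisorP[_ [->|[->]]].
Qed.

End Diameter.

Theorem theorem4p5 (S : semigroupType)
    (invS : inverse_semigroup S) (S_without_zero : ~ with_zero S) :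
  [/\ has_diameter (zero_divisor_graph0 S) (Some 1) <->
        `I_2 #<= @setT S /\ sigma S = @eq S,
      has_diameter (zero_divisor_graph0 S) (Some 2) <->
        `I_2 #<= quotient_sigma S /\ sigma S <> @eq S &
      (has_diameter (zero_divisor_graph0 S) (Some 1) \/
       has_diameter (zero_divisor_graph0 S) (Some 2)) <->
        `I_2 #<= quotient_sigma S].
Proof.
have qP := quotient_sigma_ge2P _ invS.
have d1P := diameter1P _ invS; have d2P := diameter2P _ invS.
split.
(* When [sigma] is equality, an unrelated pair is just a pair of distinct elements. *)
- split=> [/d1P[[a [b ab]] seq]|[/card_ge2P[a [b [_ _ aNb]]] seq]].
    split=> //; apply/card_ge2P; exists a, b; split=> //.
    by rewrite seq in ab.
  by apply/d1P; split=> //; exists a, b; rewrite seq.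
- by split=> [/d2P[/qP]|[/qP ns sNeq]] //; apply/d2P.
- split=> [[/d1P[/qP]|/d2P[/qP]]//|/qP ns].
  (* With two classes, whether [sigma] is equality decides between diameter 1 and diameter 2. *)
  by have [seq|sNeq] := pselect (sigma S = @eq S);
    [left; apply/d1P|right; apply/d2P].
Qed.
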